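(* Let $N=MK$ with positive integers $M,K$, and let $C>0$, $D>0$. Consider the treatment of $N=MK$ data items by $K$ batches, each containing $M$ data items, on the set of parameters $\Theta_N=\{|m|\le CM^{-1/2}\}$, and the one-by-one treatment of $K$ data items on the set of parameters $\Theta_K=\{|m|\le C\}$. Then $$N^{-1/2}R^M_{N(M)}(\Theta_N)=K^{-1/2}R^M_{K(1)}(\Theta_K).$$ Consequently these (scaled) minimax risks depend only on the number $K$ of processed batches.
   Context: Gaussian one-armed bandit with horizon $N$, variance $D$ and batch size $M$ ($N$ a multiple of $M$): at each step $i=1,\dots,N$ an action $y_i\in\{1,2\}$ is chosen and a random income $\xi_i$ depending only on the current action is received. If $y_i=2$, $\xi_i$ has density $(2\pi D)^{-1/2}\exp\{-(x-m)^2/(2D)\}$ with $D$ known and $m$ unknown; if $y_i=1$, $\xi_i$ has a known distribution with expectation $0$. The parameter is $\theta=(0,m)$; a set of parameters $\{|m|\le a\}$ means $\{\theta=(0,m):|m|\le a\}$. Strategies: the history is described by $(k,X,n)$, where $k,n$ are the numbers of past applications of the first and the second action and $X$ is the cumulative income from the second action ($X=0$ if $n=0$). A strategy $\sigma$ assigns to each history a (possibly randomized) selection of the next action; with batch size $M$, a selection is made only when $k,n$ are multiples of $M$ and the selected action is used for the next $M$ steps (one-by-one treatment is $M=1$). Loss: $L_N(\sigma,\theta)=N\max(0,m)-\mathrm{E}_{\sigma,\theta}\bigl(\sum_{i=1}^N\xi_i\bigr)$. Minimax risk: $R^M_{N(M)}(\Theta)=\inf_{\sigma}\sup_{\theta\in\Theta}L_N(\sigma,\theta)$,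 the infimum being over strategies with batch size $M$ on the horizon $N$ (the superscript $M$ in $R^M$ stands for ''minimax'', the subscript $N(M)$ shows horizon and batch size). *)

(* Defs.v *)
From HB Require Import structures.
From mathcomp Require Import all_boot all_order all_algebra.
From mathcomp Require Import all_classical all_reals all_analysis.
From mathcomp Require Import measurable_realfun.

Set Implicit Arguments.
Unset Strict Implicit.
Unset Printing Implicit Defensive.

Import Order.TTheory GRing.Theory Num.Theory.
Import numFieldNormedType.Exports.

Local Open Scope classical_set_scope.
Local Open Scope ring_scope.

Notation action := bool (only parsing).
Notation action1 := false (only parsing).
Notation action2 := true (only parsing).

(* The pairs (y_i, xi_i) observed during the first i steps, most recent first. *)
Notation trajectory R i := (i.-tuple (action * measurableTypeR R)%type)
  (only parsing).

Section histories.
Context {R : realType}.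
Implicit Types h : seq (action * measurableTypeR R).

Definition applications (a : action) h : nat := count (fun e => e.1 == a) h.

Definition total_income h : R := \sum_(e <- h) e.2.

Definition income2 h : R := \sum_(e <- h | e.1 == action2) e.2.

(* the triple (k, X, n) *)
Definition history h : nat * measurableTypeR R * nat :=
  (applications action1 h, income2 h, applications action2 h).

Definition last_action h : action := (head (action1, 0) h).1.

Definition extend i (waz : trajectory R i * action * measurableTypeR R) :
    trajectory R i.+1 :=
  [tuple of (waz.1.2, waz.2) :: waz.1.1].

Lemma measurable_extend i : measurable_fun setT (@extend i).
Proof.
apply: (@measurable_cons _ _ _ _ (fun waz => (waz.1.2, waz.2)) _
  (fun waz => waz.1.1)); last exact: (measurableT_comp measurable_fst).
apply/measurable_fun_pairP; split; last exact: measurable_snd.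
exact: (measurableT_comp measurable_snd).
Qed.

Lemma measurable_thead i :
  measurable_fun setT (fun w : trajectory R i.+1 => thead w).
Proof. exact: measurable_tnth. Qed.

Lemma measurable_applications a i :
  measurable_fun setT (fun w : trajectory R i => applications a w).
Proof.
elim: i => [|i IH].
  rewrite (_ : (fun _ => _) = cst 0%N)//.
  by apply/funext => w; rewrite tuple0.
rewrite (_ : (fun _ => _) = fun w : trajectory R i.+1 =>
    (((thead w).1 == a) + applications a [tuple of behead w])%N); last first.
  by apply/funext => w; rewrite [in LHS](tuple_eta w).
apply: measurable_fun_addn.
  apply: (@measurableT_comp _ _ _ _ _ _
    (fun e : action * measurableTypeR R => (e.1 == a : nat))).
    exact: (@measurableT_comp _ _ _ _ _ _ (fun b : bool => (b == a : nat))).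
  exact: measurable_thead.
exact: (@measurableT_comp _ _ _ _ _ _
  (fun w : trajectory R i => applications a w)) (@measurable_behead _ _ _).
Qed.

Lemma measurable_income2 i :
  measurable_fun setT (fun w : trajectory R i => income2 w : measurableTypeR R).
Proof.
elim: i => [|i IH].
  rewrite (_ : (fun _ => _) = cst 0)//.
  by apply/funext => w; rewrite tuple0 /income2 big_nil.
rewrite (_ : (fun _ => _) = fun w : trajectory R i.+1 =>
    ((if (thead w).1 then (thead w).2 else 0)
     + income2 [tuple of behead w])); last first.
  apply/funext => w; rewrite [in LHS](tuple_eta w) /income2 big_cons eqb_id.
  by case: ifP => // _; rewrite add0r.
apply: measurable_funD.
  apply: measurable_fun_ifT => //=.
    by apply: measurableT_comp => //; exact: measurable_thead.
  by apply: measurableT_comp => //; exact: measurable_thead.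
exact: (@measurableT_comp _ _ _ _ _ _
  (fun w : trajectory R i => income2 w : measurableTypeR R))
  (@measurable_behead _ _ _).
Qed.

Lemma measurable_history i :
  measurable_fun setT (fun w : trajectory R i => history w).
Proof.
apply/measurable_fun_pairP; split; last exact: measurable_applications.
apply/measurable_fun_pairP; split; first exact: measurable_applications.
exact: measurable_income2.
Qed.

Lemma measurable_last_action i :
  measurable_fun setT (fun w : trajectory R i => last_action w).
Proof.
case: i => [|i].
  by rewrite (_ : (fun _ => _) = cst action1)//; apply/funext => w; rewrite tuple0.
rewrite (_ : (fun _ => _) = fst \o (fun w : trajectory R i.+1 => thead w)).
  by apply: measurableT_comp => //; exact: measurable_thead.
by apply/funext => w /=; rewrite [in LHS](tuple_eta w).
Qed.

End histories.

(* A randomized selection given (k, X, n), measurable in the history; its values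
   at histories that do not occur, or where no selection is made, are
   irrelevant, so the same type serves for every batch size. *)
Notation strategy R := (R.-pker (nat * measurableTypeR R * nat)%type ~> action)
  (only parsing).

Section bandit.
Context {R : realType}.
Variables (P1 : probability (measurableTypeR R) R) (D : R).

Section law.
Variables (M : nat) (sigma : strategy R) (m : R).

(* normal_prob takes the standard deviation. *)
Definition income (a : action) : probability (measurableTypeR R) R :=
  if a == action2 then normal_prob m (Num.sqrt D) : probability _ R else P1.

Definition draw i (wa : trajectory R i * action) :
  {measure set (measurableTypeR R) -> \bar R} := income wa.2.

Definition select i (w : trajectory R i) : {measure set action -> \bar R} :=
  if (M %| applications action1 w)%N && (M %| applications action2 w)%N
  then sigma (history w) else \d_(last_action w).

Section kernels.
Variable i : nat.

Let measurable_draw U : measurable U ->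
  measurable_fun setT (@draw i ^~ U).
Proof.
move=> mU; apply: (@measurableT_comp _ _ _ _ _ _
  (fun a : action => income a U)) => //.
Qed.

HB.instance Definition _ := isKernel.Build _ _ _ _ R (@draw i) measurable_draw.

Let draw_prob wa : @draw i wa setT = 1%E.
Proof. exact: probability_setT. Qed.

HB.instance Definition _ :=
  Kernel_isProbability.Build _ _ _ _ R (@draw i) draw_prob.

Let measurable_select U : measurable U ->
  measurable_fun setT (@select i ^~ U).
Proof.
move=> mU; rewrite (_ : (fun _ => _) = fun w : trajectory R i =>
  if (M %| applications action1 w)%N && (M %| applications action2 w)%N
  then sigma (history w) U else (\d_(last_action w) U : \bar R)%E); last first.
  by apply/funext => w; rewrite /select; case: ifP.
apply: measurable_fun_ifT => /=.
- by apply: measurable_and;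
    apply: (@measurableT_comp _ _ _ _ _ _ (fun k : nat => (M %| k)%N)) => //;
    exact: measurable_applications.
- apply: (@measurableT_comp _ _ _ _ _ _ (sigma ^~ U)).
    exact: measurable_kernel.
  exact: measurable_history.
- exact: (measurable_kernel (kdirac (@measurable_last_action R i))).
Qed.

HB.instance Definition _ :=
  isKernel.Build _ _ _ _ R (@select i) measurable_select.

Let select_prob w : @select i w setT = 1%E.
Proof. by rewrite /select; case: ifP => _; [exact: prob_kernel|exact: diracT]. Qed.

HB.instance Definition _ :=
  Kernel_isProbability.Build _ _ _ _ R (@select i) select_prob.

Definition step : trajectory R i -> {measure set (trajectory R i.+1) -> \bar R} :=
  (@select i \; (@draw i \; kdirac (@measurable_extend R i)))%E.

HB.instance Definition _ := SFiniteKernel.copy step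
  (@select i \; (@draw i \; kdirac (@measurable_extend R i)))%E.

Let step_prob w : step w setT = 1%E.
Proof.
have draw1 wa : ((@draw i \; kdirac (@measurable_extend R i)) wa setT = 1)%E.
  rewrite /= /kcomp; under eq_integral do rewrite /kdirac /= diracT.
  by rewrite integral_cst// mul1e prob_kernel.
rewrite /step /= /kcomp; under eq_integral do rewrite draw1.
by rewrite integral_cst// mul1e prob_kernel.
Qed.

HB.instance Definition _ := Kernel_isProbability.Build _ _ _ _ R step step_prob.

Variable P : probability (trajectory R i) R.

Definition law_next (A : set (trajectory R i.+1)) : \bar R :=
  (\int[P]_w step w A)%E.

Let law_next0 : law_next set0 = 0%E.
Proof.
by rewrite /law_next; under eq_integral do rewrite measure0; rewrite integral0.
Qed.

Let law_next_ge0 A : (0 <= law_next A)%E.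
Proof. exact: integral_ge0. Qed.

Let law_next_sigma_additive : semi_sigma_additive law_next.
Proof.
move=> U mU tU mUU; rewrite [X in _ --> X](_ : _ =
  (\int[P]_w \sum_(n <oo) step w (U n))%E); last first.
  apply: eq_integral => w _.
  by apply/esym/cvg_lim => //; exact/measure_semi_sigma_additive.
apply/cvg_closeP; split.
  by apply: is_cvg_nneseries => n _ _; exact: integral_ge0.
by rewrite closeE// integral_nneseries// => n; exact: measurable_kernel.
Qed.

HB.instance Definition _ := isMeasure.Build _ _ R law_next
  law_next0 law_next_ge0 law_next_sigma_additive.

Let law_nextT : law_next setT = 1%E.
Proof.
rewrite /law_next; under eq_integral do rewrite prob_kernel.
by rewrite integral_cst// mul1e; exact: probability_setT.
Qed.

HB.instance Definition _ := Measure_isProbability.Build _ _ R law_next law_nextT.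

End kernels.

Fixpoint law (i : nat) : probability (trajectory R i) R :=
  if i is j.+1 then law_next (law j) else \d_[tuple].

End law.

Definition loss (N M : nat) (sigma : strategy R) (m : R) : \bar R :=
  ((N%:R * Num.max 0 m)%:E -
   'E_(law M sigma m N)[fun w : trajectory R N => total_income w])%E.

Definition minimax_risk (N M : nat) (Theta : set R) : \bar R :=
  ereal_inf [set ereal_sup [set loss N M sigma m | m in Theta]
            | sigma in [set: strategy R]].

End bandit.

(* The parameter theta = (0, m) is represented by m. *)
Definition parameters {R : realType} (a : R) : set R := [set m | `|m| <= a].

(* Main.v *)
(* Only the second action is informative: a batch of [M] of its incomes has the
   law [N(Mm, MD)], which is the law of [sqrt M] times one income with mean
   [sqrt M * m] and the same variance [D].  Hence, under a strategy [sigma] with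
   batch size [M], the history after [j] batches has the law of the image under
   [(k, X, n) |-> (Mk, sqrt M * X, Mn)] of the one-by-one history after [j]
   steps under the parameter [sqrt M * m] and [sigma] composed with that map.
   Since [x - m [a = 2]] is centered given the action [a], the loss is
   [N max(0, m) - m E(n)], so it gets multiplied by [sqrt M]; composition with
   the map is a surjection between strategies, so the minimax risk does too. *)

Require Import Defs.
From HB Require Import structures.
From mathcomp Require Import all_boot all_order all_algebra.
From mathcomp Require Import all_classical all_reals all_analysis.
From mathcomp Require Import measurable_realfun ring lra.

Set Implicit Arguments.
Unset Strict Implicit.
Unset Printing Implicit Defensive.

Import Order.TTheory GRing.Theory Num.Theory.
Import numFieldNormedType.Exports.

Local Open Scope classical_set_scope.
Local Open Scope ring_scope.

(** * Integration lemmas *)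

Section integrals.
Local Open Scope ereal_scope.

(** [h] and the Radon-Nikodym derivative of [nu] have the same integral over every measurable set,
    hence agree almost everywhere, and the change of variables for the derivative carries over to
    [h]. *)
Lemma ge0_integral_density d (T : measurableType d) (R : realType)
    (mu : {sigma_finite_measure set T -> \bar R})
    (nu : {finite_measure set T -> \bar R}) (h : T -> R) (f : T -> \bar R) :
  mu.-integrable setT (EFin \o h) ->
  (forall A, measurable A -> nu A = \int[mu]_(x in A) (h x)%:E) ->
  measurable_fun setT f -> (forall x, 0 <= f x) ->
  \int[nu]_x f x = \int[mu]_x (f x * (h x)%:E).
Proof.
move=> ih nuE mf f0; have numu : nu `<< mu.
  apply/null_content_dominatesP => A mA A0; rewrite nuE//.
  apply: null_set_integral => //.
  by apply: measurable_funTS; exact: (measurable_int mu).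
rewrite -(Radon_Nikodym_SigmaFinite.change_of_variables numu)//.
have irn := Radon_Nikodym_SigmaFinite.f_integrable numu.
apply: ae_eq_integral => //.
- by apply: emeasurable_funM => //; exact: (measurable_int mu).
- by apply: emeasurable_funM => //; exact: (measurable_int mu).
- apply: ae_eqe_mul2l; apply: integral_ae_eq => //.
    exact: (measurable_int mu).
  by move=> A _ mA; rewrite -nuE// -Radon_Nikodym_SigmaFinite.f_integral.
Qed.

Lemma ge0_integral_bool (R : realType) (mu : {measure set bool -> \bar R})
    (f : bool -> \bar R) : (forall b, 0 <= f b) ->
  \int[mu]_b f b = f true * mu [set true] + f false * mu [set false].
Proof.
move=> f0; rewrite setT_bool ge0_integral_setU//=; last first.
  by rewrite disj_set2E; apply/eqP/seteqP; split => // b [/= -> ].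
have i1 b : \int[mu]_(x in [set b]) f x = f b * mu [set b].
  rewrite (eq_integral (cst (f b))); last by move=> x /[!inE] ->.
  by rewrite integral_cst//.
by rewrite !i1.
Qed.

(** Mass 1 is a hypothesis because the values of a probability kernel are typed as plain
    measures. *)
Lemma integral_cst_mass1 d (T : measurableType d) (R : realType)
    (mu : {measure set T -> \bar R}) (c : \bar R) :
  mu setT = 1 -> \int[mu]_x c = c.
Proof.
by move=> mu1; rewrite -[RHS]mule1 -mu1; exact: (integral_cst mu measurableT c).
Qed.

Section random_measure.
Context d d' (X : measurableType d) (Y : measurableType d') (R : realType).
Variables (P : probability X R) (k : R.-pker X ~> Y).

(** In a composition of kernels the second one also receives the source of the first; here that
    source is the dummy [unit]. *)
Definition kernel_of_snd (ux : unit * X) : {measure set Y -> \bar R} := k ux.2.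

Let measurable_kernel_of_snd U : measurable U ->
  measurable_fun setT (kernel_of_snd ^~ U).
Proof.
move=> mU; apply: (@measurableT_comp _ _ _ _ _ _ (k ^~ U)) => //.
exact: measurable_kernel.
Qed.

HB.instance Definition _ :=
  isKernel.Build _ _ _ _ R kernel_of_snd measurable_kernel_of_snd.

Let kernel_of_snd_prob ux : kernel_of_snd ux setT = 1.
Proof. exact: prob_kernel. Qed.

HB.instance Definition _ :=
  Kernel_isProbability.Build _ _ _ _ R kernel_of_snd kernel_of_snd_prob.

(** With [P] regarded as a constant kernel on [unit], [nu] becomes a composition of kernels, whose
    integrals are iterated integrals. *)
Lemma ge0_integral_mixture (nu : {measure set Y -> \bar R}) (f : Y -> \bar R) :
  (forall A, measurable A -> nu A = \int[P]_x k x A) ->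
  measurable_fun setT f -> (forall y, 0 <= f y) ->
  \int[nu]_y f y = \int[P]_x \int[k x]_y f y.
Proof.
move=> nuE mf f0.
pose l := kprobability
  (measurable_cst (P : pprobability X R) : measurable_fun (@setT unit) _).
transitivity (\int[kcomp l kernel_of_snd tt]_y f y).
  by apply: eq_measure_integral => A mA _; rewrite nuE.
by rewrite (integral_kcomp l kernel_of_snd).
Qed.

End random_measure.

(** By uniqueness of Lebesgue measure: [a] times its image under [x |-> a * x + b] gives each
    interval []u, v]] its length. *)
Lemma ge0_integral_comp_affine (R : realType) (a b : R) (f : R -> \bar R) :
  (0 < a)%R -> measurable_fun setT f -> (forall x, 0 <= f x) ->
  \int[lebesgue_measure]_x f x =
  a%:E * \int[lebesgue_measure]_x f (a * x + b)%R.
Proof.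
move=> a0 mf f0.
pose phi (x : measurableTypeR R) : measurableTypeR R := (a * x + b)%R.
have mphi : measurable_fun setT phi.
  by apply: measurable_funD => //; exact: measurable_funM.
have s0 : (0 <= a)%R := ltW a0.
transitivity (a%:E * \int[lebesgue_measure]_x (f \o phi) x) => //.
rewrite -(ge0_integral_pushforward mphi lebesgue_measure measurableT)//.
rewrite -[a%:E]/((NngNum s0)%:num%:E) -ge0_integral_mscale//.
apply: eq_measure_integral => A mA _; apply: lebesgue_measure_unique => //.
move=> _ [[u v]] _ <-; rewrite [RHS]/(a%:E * lebesgue_measure (phi @^-1` `]u, v])).
rewrite (_ : phi @^-1` _ = `]((u - b) / a)%R, ((v - b) / a)%R]%classic); last first.
  apply/seteqP; split => x /=;
    by rewrite !in_itv/= /phi ltr_pdivrMr// ler_pdivlMr// mulrC; lra.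
rewrite !lebesgue_measure_itv/= !lte_fin ltr_pM2r ?invr_gt0// ltrD2r.
case: ltP => _ /=; last by rewrite mulr0.
by rewrite -EFinD; congr EFin; field; rewrite gt_eqF.
Qed.

Lemma ge0_integral_oppr (R : realType) (f : R -> \bar R) :
  measurable_fun setT f -> (forall x, 0 <= f x) ->
  \int[lebesgue_measure]_x f x = \int[lebesgue_measure]_x f (- x)%R.
Proof.
move=> mf f0.
pose opp : measurableTypeR R -> measurableTypeR R := -%R.
have mN : measurable_fun setT opp by exact: oppr_measurable.
transitivity (\int[lebesgue_measure]_x (f \o opp) x) => //.
rewrite -(ge0_integral_pushforward mN lebesgue_measure measurableT)//.
by apply: eq_measure_integral => A mA _; apply/esym/lebesgue_measureN.
Qed.

End integrals.

(** * Normal laws *)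

Section normal.
Context {R : realType}.
Implicit Types m s a b x : R.
Local Open Scope ereal_scope.

Lemma ge0_integral_normal m s (f : R -> \bar R) :
  measurable_fun setT f -> (forall x, 0 <= f x) ->
  \int[normal_prob m s]_x f x =
  \int[lebesgue_measure]_x (f x * (normal_pdf m s x)%:E).
Proof.
move=> mf f0.
by apply: (@ge0_integral_density _ _ _ lebesgue_measure
    (normal_prob m s : probability _ _)) => //;
  exact: integrable_normal_pdf.
Qed.

(** The factor [a] is the Jacobian of the affine change of variables. *)
Lemma normal_pdf_affine m s a b x : (0 < a)%R -> (s != 0)%R ->
  (a * normal_pdf (a * m + b) (a * s) (a * x + b))%R = normal_pdf m s x.
Proof.
move=> a0 s0; have an0 : (a != 0)%R by rewrite gt_eqF.
rewrite !normal_pdfE ?mulf_neq0//= /normal_peak /normal_fun.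
have -> : ((a * s) ^+ 2 * pi *+ 2 = a ^+ 2 * (s ^+ 2 * pi *+ 2))%R by ring.
rewrite (sqrtrM _ (sqr_ge0 a)) sqrtr_sqr gtr0_norm// invfM mulrA mulrA mulfV// mul1r.
congr (_ * expR _)%R.
by field; rewrite an0 s0.
Qed.

Lemma ge0_integral_normal_affine m s a b (f : R -> \bar R) :
  (0 < a)%R -> (s != 0)%R -> measurable_fun setT f -> (forall x, 0 <= f x) ->
  \int[normal_prob (a * m + b) (a * s)]_x f x =
  \int[normal_prob m s]_x f (a * x + b)%R.
Proof.
move=> a0 s0 mf f0.
have maff : measurable_fun setT (fun x : R => (a * x + b)%R).
  by apply: measurable_funD => //; exact: measurable_funM.
rewrite (ge0_integral_normal _ _ mf f0).
rewrite (ge0_integral_normal _ _ (measurableT_comp mf maff) (fun x => f0 _)).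
have mpdf m' s' : measurable_fun setT (fun x : R => (normal_pdf m' s' x)%:E).
  by apply/measurable_EFinP; exact: measurable_normal_pdf.
rewrite (ge0_integral_comp_affine b a0); last 2 first.
- by apply: emeasurable_funM.
- by move=> x; rewrite mule_ge0 // lee_fin normal_pdf_ge0.
rewrite -ge0_integralZl//=; last 3 first.
- apply: emeasurable_funM; first exact: measurableT_comp.
  by apply: (@measurableT_comp _ _ _ _ _ _ (fun x => (normal_pdf _ _ x)%:E)).
- by move=> x _; rewrite mule_ge0 // lee_fin normal_pdf_ge0.
- by rewrite lee_fin ltW.
apply: eq_integral => x _.
by rewrite muleCA -EFinM normal_pdf_affine.
Qed.

(* The product of the two densities is, up to a factor independent of [x], again
   a normal density in [x]; this makes the inner integral of the convolution
   equal to [1]. *)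
Lemma normal_pdf_convolution m1 s1 m2 s2 s x z :
  (s1 != 0)%R -> (s2 != 0)%R -> (s != 0)%R -> (s ^+ 2 = s1 ^+ 2 + s2 ^+ 2)%R ->
  (normal_pdf m1 s1 x * normal_pdf m2 s2 (z - x) =
   normal_pdf (m1 + m2) s z *
   normal_pdf ((m1 * s2 ^+ 2 + (z - m2) * s1 ^+ 2) / s ^+ 2) (s1 * s2 / s) x)%R.
Proof.
move=> s10 s20 s0 sE.
rewrite !normal_pdfE ?mulf_neq0 ?invr_eq0//= /normal_peak /normal_fun.
rewrite [LHS]mulrACA [RHS]mulrACA -!expRD -!invfM; congr (_^-1 * expR _)%R.
  have v0 (t : R) : (0 <= t ^+ 2 * pi *+ 2)%R.
    by rewrite mulrn_wge0// mulr_ge0 ?pi_ge0// sqr_ge0.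
  rewrite -!sqrtrM//.
  by congr Num.sqrt; field; rewrite s0.
have s120 : (s1 ^+ 2 + s2 ^+ 2 != 0)%R by rewrite -sE expf_neq0.
have -> : ((s1 * s2 / s) ^+ 2 = (s1 * s2) ^+ 2 / (s1 ^+ 2 + s2 ^+ 2))%R.
  by rewrite expr_div_n sE.
rewrite sE; field; rewrite s10 s20 s120.
by [].
Qed.

(** A sum of independent normal variables is normal: after the substitution [z = x + y], Tonelli
    allows integrating over [x] first. *)
Lemma ge0_integral_normal_convolution m1 s1 m2 s2 s (f : R -> \bar R) :
  (s1 != 0)%R -> (s2 != 0)%R -> (s != 0)%R -> (s ^+ 2 = s1 ^+ 2 + s2 ^+ 2)%R ->
  measurable_fun setT f -> (forall x, 0 <= f x) ->
  \int[normal_prob m1 s1]_x \int[normal_prob m2 s2]_y f (x + y)%R =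
  \int[normal_prob (m1 + m2) s]_z f z.
Proof.
move=> s10 s20 s0 sE mf f0.
have mpdf m' s' : measurable_fun setT (fun x : R => (normal_pdf m' s' x)%:E).
  by apply/measurable_EFinP; exact: measurable_normal_pdf.
have pdf0 m' s' x : 0 <= (normal_pdf m' s' x)%:E.
  by rewrite lee_fin normal_pdf_ge0.
have inner x : \int[normal_prob m2 s2]_y f (x + y)%R =
    \int[lebesgue_measure]_z (f z * (normal_pdf m2 s2 (z - x))%:E).
  have maddx : measurable_fun setT (fun y : R => x + y)%R by exact: measurable_funD.
  rewrite (ge0_integral_normal m2 s2 (measurableT_comp mf maddx) (fun y => f0 _)).
  rewrite [RHS](ge0_integral_comp_affine x ltr01); last 2 first.
  - apply: emeasurable_funM => //.
    apply: (@measurableT_comp _ _ _ _ _ _ (fun x => (normal_pdf _ _ x)%:E)) => //.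
    exact: measurable_funB.
  - by move=> y; rewrite mule_ge0.
  rewrite mul1e; apply: eq_integral => y _.
  by rewrite mul1r addrK addrC.
(* [f z] times the joint density of [x] and [z = x + y]. *)
pose g (xz : R * R) := f xz.2 * (normal_pdf m1 s1 xz.1 * normal_pdf m2 s2 (xz.2 - xz.1))%:E.
have mg : measurable_fun setT g.
  apply: emeasurable_funM; first exact: measurableT_comp.
  apply/measurable_EFinP; apply: measurable_funM.
    apply: (@measurableT_comp _ _ _ _ _ _ (normal_pdf m1 s1)) => //.
    exact: measurable_normal_pdf.
  apply: (@measurableT_comp _ _ _ _ _ _ (normal_pdf m2 s2)).
    exact: measurable_normal_pdf.
  exact: measurable_funB.
have g0 xz : 0 <= g xz by rewrite mule_ge0// EFinM mule_ge0.
transitivity (\int[lebesgue_measure]_x \int[lebesgue_measure]_z g (x, z)).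
  have mF : measurable_fun setT (fun x : R => \int[normal_prob m2 s2]_y f (x + y)%R).
    apply: (@measurable_fun_fubini_tonelli_F _ _ (measurableTypeR R) (measurableTypeR R) R
      (normal_prob m2 s2 : probability _ R) (fun xy : R * R => f (xy.1 + xy.2)%R)).
      by apply: measurableT_comp => //; exact: measurable_funD.
    by move=> xy; exact: f0.
  rewrite (ge0_integral_normal m1 s1 mF); last first.
    by move=> x; apply: integral_ge0 => y _; exact: f0.
  apply: eq_integral => x _; rewrite inner muleC -ge0_integralZl//.
  - by apply: eq_integral => z _; rewrite /g/= EFinM muleCA.
  - apply: emeasurable_funM => //.
    apply: (@measurableT_comp _ _ _ _ _ _ (fun x => (normal_pdf _ _ x)%:E)) => //.
    exact: measurable_funB.
  - by move=> y _; rewrite mule_ge0.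
rewrite (@fubini_tonelli _ _ (measurableTypeR R) (measurableTypeR R) R
  lebesgue_measure lebesgue_measure _ mg g0) (ge0_integral_normal _ _ mf f0).
apply: eq_integral => z _.
under eq_integral => x _.
  rewrite /g/= (normal_pdf_convolution _ _ _ _ s10 s20 s0 sE) EFinM muleA.
  over.
rewrite ge0_integralZl//; [|exact: mpdf|by rewrite mule_ge0].
by rewrite integral_normal_pdf mule1.
Qed.


(** [|x - m|] times the density is dominated by a multiple of the normal density with doubled
    variance. *)
Lemma integrable_normal_center m s : (s != 0)%R ->
  (normal_prob m s).-integrable setT (fun x => (x - m)%:E).
Proof.
move=> s0; apply/integrableP; split.
  by apply/measurable_EFinP; exact: measurable_funB.
have s20 : (Num.sqrt 2 * s != 0)%R by rewrite mulf_neq0// gt_eqF// sqrtr_gt0.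
have mnorm : measurable_fun setT (fun x : R => `|(x - m)%:E|).
  by apply: measurableT_comp => //; apply/measurable_EFinP; exact: measurable_funB.
have mpdf m' s' : measurable_fun setT (fun x : R => (normal_pdf m' s' x)%:E).
  by apply/measurable_EFinP; exact: measurable_normal_pdf.
rewrite (ge0_integral_normal m s mnorm (fun x => abse_ge0 _)).
(* The factor [|s|] comes from [|x - m| = |s| * t] below; the quotient of peaks exchanges the two
   normalizing constants. *)
pose c := (`|s| * (normal_peak s / normal_peak (Num.sqrt 2 * s)))%R.
apply: (@le_lt_trans _ _ (\int[lebesgue_measure]_x
    (c%:E * (normal_pdf m (Num.sqrt 2 * s) x)%:E))); last first.
  rewrite integralZl//; last exact: integrable_normal_pdf.
  by rewrite integral_normal_pdf mule1 ltry.
apply: ge0_le_integral => //.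
- by move=> x _; rewrite mule_ge0// lee_fin normal_pdf_ge0.
- by apply: emeasurable_funM => //; exact: mpdf.
- by apply: emeasurable_funM => //; exact: mpdf.
move=> x _; rewrite -!EFinM lee_fin !normal_pdfE//= /c.
have peak0 := normal_peak_gt0 s20.
rewrite [leRHS](_ : _ = normal_peak s * (`|s| * normal_fun m (Num.sqrt 2 * s) x))%R; last first.
  by field; rewrite gt_eqF.
rewrite mulrCA ler_pM2l ?normal_peak_gt0// /normal_fun.
pose t := (`|x - m| / `|s|)%R.
have ns0 : (0 < `|s|)%R by rewrite normr_gt0.
have t2 : (t ^+ 2 = (x - m) ^+ 2 / s ^+ 2)%R by rewrite expr_div_n !real_normK// num_real.
have -> : `|x - m|%R = (`|s| * t)%R by rewrite /t mulrC divfK// gt_eqF.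
rewrite -mulrA ler_pM2l//.
have -> : (- (x - m) ^+ 2 / (s ^+ 2 *+ 2) = - t ^+ 2 / 2)%R by rewrite t2; field.
have -> : (- (x - m) ^+ 2 / ((Num.sqrt 2 * s) ^+ 2 *+ 2) = - t ^+ 2 / 2 + t ^+ 2 / 4)%R.
  by rewrite t2 exprMn sqr_sqrtr//; field.
rewrite expRD mulrC ler_pM2l ?expR_gt0//.
(* [t <= 1 + t^2/4 <= exp (t^2/4)] bounds [t exp (-t^2/2)] by a wider Gaussian. *)
apply: le_trans (expR_ge1Dx _).
by have := sqr_ge0 (t / 2 - 1)%R; nra.
Qed.

(** The density is symmetric about [m]. The reflection is split into a translation by [- (2 * m)]
    and a negation, since the affine change of variables asks for a positive slope. *)
Lemma ge0_integral_normal_reflection m s (f : R -> \bar R) : (s != 0)%R ->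
  measurable_fun setT f -> (forall x, 0 <= f x) ->
  \int[normal_prob m s]_x f x = \int[normal_prob m s]_x f (2 * m - x)%R.
Proof.
move=> s0 mf f0.
have mpdf : measurable_fun setT (fun x : R => (normal_pdf m s x)%:E).
  by apply/measurable_EFinP; exact: measurable_normal_pdf.
have mrefl : measurable_fun setT (fun x : R => (2 * m - x)%R) by exact: measurable_funB.
have mfpdf : measurable_fun setT (fun x : R => f x * (normal_pdf m s x)%:E).
  exact: emeasurable_funM.
have fpdf0 x : 0 <= f x * (normal_pdf m s x)%:E.
  by rewrite mule_ge0// lee_fin normal_pdf_ge0.
rewrite (ge0_integral_normal m s mf f0).
rewrite (ge0_integral_normal m s (measurableT_comp mf mrefl) (fun x => f0 _)).
rewrite (ge0_integral_oppr mfpdf fpdf0).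
rewrite (ge0_integral_comp_affine (- (2 * m)) ltr01
  (measurableT_comp mfpdf (@oppr_measurable R setT)) (fun x => fpdf0 _)).
rewrite mul1e; apply: eq_integral => x _ /=.
rewrite mul1r opprB; congr (_ * _%:E).
rewrite !normal_pdfE// /normal_fun; congr (_ * expR _)%R.
by congr (- _ / _)%R; ring.
Qed.

(** The reflection about [m] exchanges the positive and negative parts of [x - m]; their common
    integral is finite, so the difference is [0]. *)
Lemma integral_normal_center m s : (s != 0)%R ->
  \int[normal_prob m s]_x (x - m)%:E = 0.
Proof.
move=> s0; have ic := integrable_normal_center m s0.
rewrite integralE.
rewrite (_ : \int[_]_x _^\+ x = \int[normal_prob m s]_x (fun x => (x - m)%:E)^\- x).
  by rewrite subee//; apply: integrable_neg_fin_num.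
rewrite (ge0_integral_normal_reflection m s0 (measurable_funepos (measurable_int _ ic)))//.
apply: eq_integral => x _; rewrite funeposE funenegE; congr maxe.
by rewrite -EFinN; congr EFin; ring.
Qed.

End normal.

(** * The bandit as a Markov chain on histories *)

Section process.
Context {R : realType}.
Variables (P1 : probability (measurableTypeR R) R) (D : R).
Implicit Types (sigma : strategy R) (m : R).
Local Open Scope ereal_scope.

Notation hist := (nat * measurableTypeR R * nat)%type.

(* Within a batch the last action is repeated, so the history alone is not
   Markov: the last action has to be added. *)
Notation state := (hist * bool)%type.

Definition state_of (h : seq (action * measurableTypeR R)) : state :=
  (history h, last_action h).

(** The effect of [r] consecutive uses of [a] with total income [x]: a single step for [r = 1], a
    part of a batch or a whole one otherwise. *)
Definition push (r : nat) (h : hist) (a : action) (x : R) : hist :=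
  if a then (h.1.1, x + h.1.2, (r + h.2)%N)%R else ((r + h.1.1)%N, h.1.2, h.2).

(** At [state_of w] this is convertible to [select M sigma w], on which [expectS] relies. *)
Definition selection M sigma (s : state) : {measure set action -> \bar R} :=
  if (M %| s.1.1.1)%N && (M %| s.1.2)%N then sigma s.1 else \d_(s.2).

(** The Markov operator of the chain of states, acting on test functions; laws are compared through
    [expect] alone, so no law on states is constructed. *)
Definition transition M sigma m (F : state -> \bar R) (s : state) : \bar R :=
  \int[selection M sigma s]_a \int[income P1 D m a]_x F (push 1 s.1 a x, a).

Definition expect M sigma m i (F : state -> \bar R) : \bar R :=
  \int[law P1 D M sigma m i]_w F (state_of w).

Lemma measurable_state_of i :
  measurable_fun setT (fun w : trajectory R i => state_of w).
Proof.
apply/measurable_fun_pairP; split; first exact: measurable_history.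
exact: measurable_last_action.
Qed.

Lemma state_of_extend i (wax : trajectory R i * action * measurableTypeR R) :
  state_of (extend wax) = (push 1 (history wax.1.1) wax.1.2 wax.2, wax.1.2).
Proof.
case: wax => -[w a] x; rewrite /state_of /history /push /income2 /applications/=.
by rewrite big_cons /=; case: a.
Qed.

(** [step] is a composition of three kernels, the last of which is a Dirac mass and merely evaluates
    [f] at the extended trajectory. *)
Lemma ge0_integral_law_next M sigma m i (P : probability (trajectory R i) R)
    (f : trajectory R i.+1 -> \bar R) :
  measurable_fun setT f -> (forall w, 0 <= f w) ->
  \int[law_next P1 D M sigma m P]_w f w =
  \int[P]_w \int[select M sigma w]_a \int[income P1 D m a]_x f (extend (w, a, x)).
Proof.
move=> mf f0.
rewrite (@ge0_integral_mixture _ _ _ _ _ P (step P1 D M sigma m (i:=i) : R.-pker _ ~> _))//.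
apply: eq_integral => w _; rewrite /step.
rewrite (@integral_kcomp _ _ _ _ _ _ _ (select M sigma (i:=i))
  (draw P1 D m (i:=i) \; kdirac (@measurable_extend R i)) w f f0 mf).
apply: eq_integral => a _.
rewrite (@integral_kcomp _ _ _ _ _ _ _ (draw P1 D m (i:=i))
  (kdirac (@measurable_extend R i)) (w, a) f f0 mf).
apply: eq_integral => x _.
by rewrite /kdirac/= integral_dirac// diracT mul1e.
Qed.

(** [false] is the default of [last_action] on the empty trajectory; the first action is still
    chosen by [sigma], as [M] divides [0]. *)
Lemma expect0 M sigma m (F : state -> \bar R) : measurable_fun setT F ->
  expect M sigma m 0 F = F (0%N, 0%R, 0%N, false).
Proof.
move=> mF; rewrite /expect/= integral_dirac//; last first.
  by apply: measurableT_comp => //; exact: measurable_state_of.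
by rewrite diracT mul1e /state_of /history /income2 big_nil.
Qed.

Lemma expectS M sigma m i (F : state -> \bar R) :
  measurable_fun setT F -> (forall s, 0 <= F s) ->
  expect M sigma m i.+1 F = expect M sigma m i (transition M sigma m F).
Proof.
move=> mF F0; have mFs := measurableT_comp mF (@measurable_state_of i.+1).
rewrite [LHS](ge0_integral_law_next M sigma m _ mFs (fun w => F0 _)).
apply: eq_integral => w _; apply: eq_integral => a _; apply: eq_integral => x _.
rewrite /=; congr (F _); exact: (state_of_extend (w, a, x)).
Qed.

Lemma transition_ge0 M sigma m (F : state -> \bar R) s :
  (forall s, 0 <= F s) -> 0 <= transition M sigma m F s.
Proof. by move=> F0; do 2 (apply: integral_ge0 => ? _). Qed.

Lemma measurable_push r a :
  measurable_fun setT (fun hx : hist * measurableTypeR R => push r hx.1 a hx.2).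
Proof.
have mk : measurable_fun setT (fun hx : hist * measurableTypeR R => hx.1.1.1).
  by apply: (measurableT_comp measurable_fst); apply: (measurableT_comp measurable_fst).
have mX : measurable_fun setT
    (fun hx : hist * measurableTypeR R => hx.1.1.2 : measurableTypeR R).
  by apply: (measurableT_comp measurable_snd); apply: (measurableT_comp measurable_fst).
have mn : measurable_fun setT (fun hx : hist * measurableTypeR R => hx.1.2).
  by apply: (measurableT_comp measurable_snd).
have maddn (f : hist * measurableTypeR R -> nat) : measurable_fun setT f ->
    measurable_fun setT (fun hx => (r + f hx)%N).
  by apply: (@measurableT_comp _ _ _ _ _ _ (addn r)).
case: a; rewrite /push.
  apply/measurable_fun_pairP; split; last exact: maddn.
  apply/measurable_fun_pairP; split => //=.
  by apply: measurable_funD.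
by do 2 (apply/measurable_fun_pairP; split => //=); exact: maddn.
Qed.

Lemma measurable_selection M sigma U : measurable U ->
  measurable_fun setT (selection M sigma ^~ U).
Proof.
move=> mU; rewrite (_ : (fun _ => _) = fun s : state =>
  if (M %| s.1.1.1)%N && (M %| s.1.2)%N then sigma s.1 U else \d_(s.2) U); last first.
  by apply/funext => s; rewrite /selection; case: ifP.
apply: measurable_fun_ifT => /=.
- apply: measurable_and;
    apply: (@measurableT_comp _ _ _ _ _ _ (fun k : nat => (M %| k)%N)) => //.
    by apply: (measurableT_comp measurable_fst); apply: (measurableT_comp measurable_fst).
  by apply: (measurableT_comp measurable_snd).
- apply: (@measurableT_comp _ _ _ _ _ _ (sigma ^~ U)) => //.
  exact: measurable_kernel.
- by apply: (@measurableT_comp _ _ _ _ _ _ (fun a : bool => \d_a U : \bar R)).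
Qed.

(** With only two actions the outer integral is a sum of two products; each inner integral is
    measurable by Tonelli. *)
Lemma measurable_transition M sigma m (F : state -> \bar R) :
  measurable_fun setT F -> (forall s, 0 <= F s) ->
  measurable_fun setT (transition M sigma m F).
Proof.
move=> mF F0.
pose V a (s : state) := \int[income P1 D m a]_x F (push 1 s.1 a x, a).
have mV a : measurable_fun setT (V a).
  apply: (@measurable_fun_fubini_tonelli_F _ _ state (measurableTypeR R) R
    (income P1 D m a) (fun sx : state * measurableTypeR R => F (push 1 sx.1.1 a sx.2, a))).
    apply: (measurableT_comp mF); apply/measurable_fun_pairP; split.
      apply: (measurableT_comp (measurable_push 1 a)
        (g := fun sx : state * measurableTypeR R => (sx.1.1, sx.2))).
      apply/measurable_fun_pairP; split; last exact: measurable_snd.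
      exact: (measurableT_comp measurable_fst measurable_fst).
    exact: measurable_cst.
  by move=> sx; exact: F0.
rewrite (_ : transition M sigma m F = fun s =>
    V true s * selection M sigma s [set true] +
    V false s * selection M sigma s [set false]); last first.
  apply/funext => s; rewrite /transition ge0_integral_bool// => a.
  exact: integral_ge0.
by apply: emeasurable_funD; apply: emeasurable_funM => //; exact: measurable_selection.
Qed.

End process.

(** * Batches *)

Section batches.
Context {R : realType}.
Variables (P1 : probability (measurableTypeR R) R) (D : R) (hD : 0 < D).
Variables (M : nat) (hM : (0 < M)%N) (m : R).
Local Open Scope ereal_scope.

Notation hist := (nat * measurableTypeR R * nat)%type.
Notation state := (hist * bool)%type.

Definition rescale (h : hist) : hist :=
  ((M * h.1.1)%N, Num.sqrt M%:R * h.1.2, (M * h.2)%N)%R.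

Definition rescale_state (s : state) : state := (rescale s.1, s.2).

Lemma measurable_rescale : measurable_fun setT rescale.
Proof.
apply/measurable_fun_pairP; split; last first.
  by apply: (measurableT_comp (f := muln M)).
apply/measurable_fun_pairP; split.
  apply: (measurableT_comp (f := muln M)) => //.
  exact: (measurableT_comp measurable_fst measurable_fst).
apply: measurable_funM => //.
exact: (measurableT_comp measurable_snd measurable_fst).
Qed.

Lemma measurable_rescale_state : measurable_fun setT rescale_state.
Proof.
apply/measurable_fun_pairP; split; last exact: measurable_snd.
exact: (measurableT_comp measurable_rescale measurable_fst).
Qed.

(* For the first action the values drawn are discarded, so the normal law may
   serve for both actions. *)
Definition batch_income r : probability (measurableTypeR R) R :=
  normal_prob (r%:R * m) (Num.sqrt (r%:R * D)).

Let sqrt_neq0 r : (0 < r)%N -> (Num.sqrt (r%:R * D) != 0)%R.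
Proof. by move=> r0; rewrite gt_eqF// sqrtr_gt0 mulr_gt0// ltr0n. Qed.

Let integral_prob_cst (P : probability (measurableTypeR R) R) (c : \bar R) :
  \int[P]_x c = c.
Proof. by apply: integral_cst_mass1; exact: probability_setT. Qed.

(** Incomes of the first action are not recorded in the history, so the integrand is constant; [0]
    is a placeholder. *)
Let integral_push_action1 (P : probability (measurableTypeR R) R) r h
    (F : state -> \bar R) :
  \int[P]_x F (push r h action1 x, action1) = F (push r h action1 0%R, action1).
Proof. exact: (integral_prob_cst P (F (push r h action1 0%R, action1))). Qed.

Lemma measurable_after_push r h a (F : state -> \bar R) :
  measurable_fun setT F -> measurable_fun setT (fun x : R => F (push r h a x, a)).
Proof.
move=> mF; apply: (measurableT_comp mF); apply/measurable_fun_pairP; split.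
  apply: (measurableT_comp (measurable_push r a) (g := fun x => (h, x))).
  by apply/measurable_fun_pairP; split; [exact: measurable_cst|exact: measurable_id].
exact: measurable_cst.
Qed.

Lemma integral_batch_income1 h a (F : state -> \bar R) :
  \int[income P1 D m a]_x F (push 1 h a x, a) =
  \int[batch_income 1]_x F (push 1 h a x, a).
Proof.
case: a; first by rewrite /batch_income !mul1r.
exact: etrans (integral_push_action1 P1 1 h F)
  (esym (integral_push_action1 (batch_income 1) 1 h F)).
Qed.

(** For the second action this is the convolution of [N(rm, rD)] with [N(m, D)], where [0 < r] keeps
    the first law nondegenerate; for the first action both sides are constants. *)
Lemma integral_batch_incomeS r h a (F : state -> \bar R) :
  (0 < r)%N -> measurable_fun setT F -> (forall s, 0 <= F s) ->
  \int[batch_income r]_x \int[income P1 D m a]_y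
    F (push 1 (push r h a x) a y, a) =
  \int[batch_income r.+1]_x F (push r.+1 h a x, a).
Proof.
move=> r0 mF F0; case: a; last first.
  pose c := F (push r.+1 h action1 0%R, action1).
  transitivity (\int[batch_income r]_x c).
    by apply: eq_integral => x _; exact: (integral_push_action1 P1 1 (push r h action1 x) F).
  transitivity c; first exact: (integral_prob_cst (batch_income r) c).
  exact/esym/(integral_push_action1 (batch_income r.+1) r.+1 h F).
transitivity (\int[batch_income r]_x \int[normal_prob m (Num.sqrt D)]_y
    F (push r.+1 h true (x + y)%R, true)).
  apply: eq_integral => x _; apply: eq_integral => y _.
  by rewrite /push/= addrA (addrC y) addnA.
have sD0 : (Num.sqrt D != 0)%R by rewrite gt_eqF// sqrtr_gt0.
have sE : (Num.sqrt (r.+1%:R * D) ^+ 2 =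
    Num.sqrt (r%:R * D) ^+ 2 + Num.sqrt D ^+ 2)%R.
  have D0 := ltW hD.
  by rewrite !sqr_sqrtr// ?mulr_ge0// -natr1 mulrDl mul1r.
rewrite /batch_income -[in RHS]natr1 mulrDl mul1r natr1.
exact: (ge0_integral_normal_convolution _ _ (sqrt_neq0 r0) sD0
  (sqrt_neq0 (ltn0Sn r)) sE (measurable_after_push r.+1 h action2 mF) (fun=> F0 _)).
Qed.

(** [N(Mm, MD)] is the image of [N(sqrt M * m, D)] under multiplication by [sqrt M], which is how
    [rescale] acts on incomes. *)
Lemma integral_batch_income_rescale h a (F : state -> \bar R) :
  measurable_fun setT F -> (forall s, 0 <= F s) ->
  \int[batch_income M]_x F (push M (rescale h) a x, a) =
  \int[income P1 D (Num.sqrt M%:R * m) a]_x F (rescale_state (push 1 h a x, a)).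
Proof.
move=> mF F0; case: a; last first.
  rewrite [LHS](integral_push_action1 _ M (rescale h) F).
  rewrite [RHS](integral_push_action1 P1 1 h (F \o rescale_state)); congr (F _).
  by rewrite /rescale_state /push /rescale/= mulnDr muln1.
have M0 : (0 < Num.sqrt M%:R :> R)%R by rewrite sqrtr_gt0 ltr0n.
rewrite /batch_income (_ : M%:R * m = Num.sqrt M%:R * (Num.sqrt M%:R * m) + 0)%R; last first.
  by rewrite addr0 mulrA -expr2 sqr_sqrtr.
have sD0 : (Num.sqrt D != 0)%R by rewrite gt_eqF// sqrtr_gt0.
rewrite (sqrtrM D (ler0n R M)).
rewrite [LHS](ge0_integral_normal_affine _ 0 M0 sD0
  (measurable_after_push M (rescale h) action2 mF) (fun=> F0 _)).
apply: eq_integral => x _; congr (F _).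
by rewrite /rescale_state /push /rescale/= addr0 mulrDr mulnDr muln1.
Qed.

(** The strategies are tied by a relation, so that either one may later be constructed from the
    other. *)
Variables (sigma sigma1 : strategy R).
Hypothesis sigma1E : forall h, sigma1 h = sigma (rescale h) :> {measure set _ -> \bar R}.

Let selection_rescale s : selection M sigma (rescale_state s) = sigma1 s.1.
Proof. by rewrite /selection/= !dvdn_mulr// sigma1E. Qed.

(** Strictly inside a batch the count of the current action is [r] modulo [M], so the last action is
    repeated. *)
Let selection_batch r h a x : (0 < r < M)%N ->
  selection M sigma (push r (rescale h) a x, a) = \d_a.
Proof.
move=> /andP[r0 rM]; rewrite /selection /push.
by case: a => /=; rewrite dvdn_addl ?dvdn_mulr// gtnNdvd// ?andbF.
Qed.

Let selection1 s : selection 1 sigma1 s = sigma1 s.1.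
Proof. by rewrite /selection !dvd1n. Qed.

(** Induction on batches, with an inner induction on the steps of one batch. [F] stays general in
    both, because each step replaces it by its transition. *)
Lemma expect_batch j (F : state -> \bar R) :
  measurable_fun setT F -> (forall s, 0 <= F s) ->
  expect P1 D M sigma m (M * j) F =
  expect P1 D 1 sigma1 (Num.sqrt M%:R * m) j (F \o rescale_state).
Proof.
elim: j F => [|j IH] F mF F0.
  rewrite muln0 !expect0//; last exact: measurableT_comp measurable_rescale_state.
  by rewrite /= /rescale_state /rescale/= mulr0 muln0.
(* [r] starts at [1]: the first step of the batch makes the selection, the later ones only add
   income. *)
have within r : (0 < r <= M)%N -> forall F : state -> \bar R,
    measurable_fun setT F -> (forall s, 0 <= F s) ->
    expect P1 D M sigma m (M * j + r) F =
    expect P1 D 1 sigma1 (Num.sqrt M%:R * m) j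
      (fun s => \int[sigma1 s.1]_a \int[batch_income r]_x
         F (push r (rescale s.1) a x, a)).
  elim: r => // -[_ _|r IHr rM] {mF F0}F mF F0.
    rewrite addn1 expectS// IH; last 2 first.
    - exact: measurable_transition.
    - by move=> s; exact: transition_ge0.
    apply: eq_integral => w _; rewrite /= /transition selection_rescale.
    apply: eq_integral => a _; exact: integral_batch_income1.
  rewrite addnS expectS// IHr; last 3 first.
  - by rewrite /= ltnW//.
  - exact: measurable_transition.
  - by move=> s; exact: transition_ge0.
  apply: eq_integral => w _; apply: eq_integral => a _.
  rewrite -[RHS](integral_batch_incomeS (rescale (state_of w).1) a (ltn0Sn r) mF F0).
  apply: eq_integral => x _.
  (* The batch is not complete yet, so the selection is a Dirac mass at [a] and only the integral
     over the new income remains. *)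
  rewrite /transition selection_batch; last by rewrite ltn0Sn.
  by rewrite integral_dirac// diracT mul1e.
have hMM : (0 < M <= M)%N by rewrite hM leqnn.
rewrite mulnS addnC (within M hMM F mF F0).
rewrite [RHS](expectS _ _ _ _ _ _ (measurableT_comp mF measurable_rescale_state) (fun=> F0 _)).
apply: eq_integral => w _; rewrite /transition selection1.
apply: eq_integral => a _.
exact: (integral_batch_income_rescale (state_of w).1 a mF F0).
Qed.

End batches.

(** * Expected loss *)

Section expected_loss.
Context {R : realType}.
Variables (P1 : probability (measurableTypeR R) R) (D : R) (hD : 0 < D).
Hypothesis hP1 : P1.-integrable [set: measurableTypeR R] (EFin \o idfun).
Hypothesis hP1_mean : ('E_P1[idfun] = 0)%E.
Variables (M : nat) (sigma : strategy R) (m : R).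
Local Open Scope ereal_scope.

(** The income minus its conditional mean given the action. *)
Definition centered (e : action * measurableTypeR R) : R :=
  (e.2 - m * (e.1 == action2)%:R)%R.

Definition centered_income (h : seq (action * measurableTypeR R)) : R :=
  \sum_(e <- h) centered e.

Lemma centered_incomeE h :
  centered_income h = (total_income h - m * (applications action2 h)%:R)%R.
Proof.
elim: h => [|e h IH].
  by rewrite /centered_income /total_income !big_nil mulr0 subr0.
rewrite /centered_income /total_income /applications !big_cons /= natrD.
rewrite -/(centered_income h) IH /centered /total_income /applications; ring.
Qed.

Lemma measurable_centered : measurable_fun setT centered.
Proof.
apply: measurable_funB; first exact: measurable_snd.
apply: measurable_funM => //.
by apply: (measurableT_comp (f := fun a : bool => (a == action2)%:R : R)).
Qed.

Lemma integrable_centered a :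
  (income P1 D m a).-integrable setT (fun x => (centered (a, x))%:E).
Proof.
case: a; rewrite /centered/=.
  under eq_fun do rewrite mulr1.
  by apply: integrable_normal_center; rewrite gt_eqF// sqrtr_gt0.
by under eq_fun do rewrite mulr0 subr0.
Qed.

Lemma integral_centered a : \int[income P1 D m a]_x (centered (a, x))%:E = 0.
Proof.
case: a; rewrite /centered/=.
  under eq_integral do rewrite mulr1.
  by apply: integral_normal_center; rewrite gt_eqF// sqrtr_gt0.
under eq_integral do rewrite mulr0 subr0.
by move: hP1_mean; rewrite unlock.
Qed.

Section one_step.
Variables (i : nat) (P : probability (trajectory R i) R).

Let Q := law_next P1 D M sigma m P.

(** The newest pair is the head, so [behead] recovers the past, whose law is still [P]. *)
Let ge0_integral_behead (f : trajectory R i -> \bar R) :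
  measurable_fun setT f -> (forall w, 0 <= f w) ->
  \int[Q]_w f [tuple of behead w] = \int[P]_w f w.
Proof.
move=> mf f0.
rewrite [LHS](ge0_integral_law_next P1 D M sigma m P
  (measurableT_comp mf (@measurable_behead _ _ _)) (fun=> f0 _)).
apply: eq_integral => w _.
transitivity (\int[select M sigma w]_a f w); last first.
  by apply: (integral_cst_mass1 (mu := select M sigma w)); exact: prob_kernel.
apply: eq_integral => a _.
transitivity (\int[income P1 D m a]_x f w); last first.
  by apply: (integral_cst_mass1 (mu := income P1 D m a)); exact: probability_setT.
by apply: eq_integral => x _; congr f; exact: val_inj.
Qed.

Lemma integrable_behead (f : trajectory R i -> \bar R) :
  P.-integrable setT f -> Q.-integrable setT (fun w => f [tuple of behead w]).
Proof.
move=> /integrableP[mf fi]; apply/integrableP; split.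
  exact: (measurableT_comp mf (@measurable_behead _ _ _)).
by rewrite (ge0_integral_behead (measurableT_comp (@abse_measurable R setT) mf)
  (fun=> abse_ge0 _)).
Qed.

Lemma integral_behead (f : trajectory R i -> \bar R) :
  measurable_fun setT f ->
  \int[Q]_w f [tuple of behead w] = \int[P]_w f w.
Proof.
move=> mf; rewrite [LHS]integralE [RHS]integralE; congr (_ - _).
  rewrite -(ge0_integral_behead (measurable_funepos mf) (fun=> funepos_ge0 _ _)).
  by apply: eq_integral => w _; rewrite !funeposE.
rewrite -(ge0_integral_behead (measurable_funeneg mf) (fun=> funeneg_ge0 _ _)).
by apply: eq_integral => w _; rewrite !funenegE.
Qed.

Let ge0_integral_thead (g : action * measurableTypeR R -> \bar R) :
  measurable_fun setT g -> (forall e, 0 <= g e) ->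
  \int[Q]_w g (thead w) =
  \int[P]_w \int[select M sigma w]_a \int[income P1 D m a]_x g (a, x).
Proof.
move=> mg g0.
exact: (ge0_integral_law_next P1 D M sigma m P
  (measurableT_comp mg (@measurable_thead R i)) (fun=> g0 _)).
Qed.

Let mcentered : measurable_fun setT (EFin \o centered).
Proof. by apply/measurable_EFinP; exact: measurable_centered. Qed.

(** The absolute moment given the action takes two finite values; their sum bounds it whatever is
    selected. *)
Lemma integrable_centered_thead :
  Q.-integrable setT (fun w => (centered (thead w))%:E).
Proof.
apply/integrableP; split.
  exact: (measurableT_comp mcentered (@measurable_thead R i)).
rewrite (ge0_integral_thead
  (measurableT_comp (@abse_measurable R setT) mcentered) (fun=> abse_ge0 _)).
pose c a := \int[income P1 D m a]_x `|(centered (a, x))%:E|.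
have c0 a : 0 <= c a by exact: integral_ge0.
have cfin a : c a < +oo by case/integrableP: (integrable_centered a).
have cle a : c a <= c true + c false.
  by case: a; [rewrite leeDl|rewrite leeDr].
apply: (@le_lt_trans _ _ (\int[P]_w (c true + c false))); last first.
  rewrite integral_cst_mass1; last exact: probability_setT.
  exact: lte_add_pinfty.
apply: ge0_le_integral => //.
- by move=> w _; apply: integral_ge0 => a _; exact: c0.
- exact: (measurable_fun_integral_kernel (measurable_kernel (select M sigma (i:=i))) c0).
- move=> w _; apply: (@le_trans _ _ (\int[select M sigma w]_a (c true + c false))).
    by apply: ge0_le_integral => // a _; [exact: c0|exact: cle].
  by rewrite (integral_cst_mass1 (mu := select M sigma w))//; exact: prob_kernel.
Qed.

(** The one-step formula is for nonnegative functions, so positive and negative parts are compared: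
    given the action, their integrals agree by [integral_centered]. *)
Lemma integral_centered_thead : \int[Q]_w (centered (thead w))%:E = 0.
Proof.
have ic := integrable_centered_thead.
rewrite integralE.
rewrite (_ : \int[Q]_w _^\+ w = \int[Q]_w (fun w => (centered (thead w))%:E)^\- w).
  by rewrite subee//; exact: integrable_neg_fin_num.
transitivity (\int[Q]_w (EFin \o centered)^\+ (thead w)).
  by apply: eq_integral => w _; rewrite !funeposE.
transitivity (\int[Q]_w (EFin \o centered)^\- (thead w)); last first.
  by apply: eq_integral => w _; rewrite !funenegE.
rewrite (ge0_integral_thead (measurable_funepos mcentered) (fun=> funepos_ge0 _ _)).
rewrite (ge0_integral_thead (measurable_funeneg mcentered) (fun=> funeneg_ge0 _ _)).
apply: eq_integral => w _; apply: eq_integral => a _.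
transitivity (\int[income P1 D m a]_x (fun x => (centered (a, x))%:E)^\+ x).
  by apply: eq_integral => x _; rewrite !funeposE.
transitivity (\int[income P1 D m a]_x (fun x => (centered (a, x))%:E)^\- x); last first.
  by apply: eq_integral => x _; rewrite !funenegE.
have := integral_centered a; rewrite integralE => /eqP.
rewrite sube_eq ?add0e; first by move/eqP.
  exact: (integrable_pos_fin_num _ (integrable_centered a)).
by rewrite fin_num_adde_defl//; exact: (integrable_neg_fin_num _ (integrable_centered a)).
Qed.

End one_step.

(** The newest term has mean [0], and the rest is handled by the induction hypothesis. Integrability
    is proved along with it, as additivity of the integral needs it. *)
Lemma integral_centered_income i :
  (law P1 D M sigma m i).-integrable setT (fun w => (centered_income w)%:E) /\
  \int[law P1 D M sigma m i]_w (centered_income w)%:E = 0.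
Proof.
elim: i => [|i [IHi IH0]].
  have -> : (fun w : trajectory R 0 => (centered_income w)%:E) = cst 0.
    by apply/funext => w; rewrite tuple0 /centered_income big_nil.
  by split; [exact: integrable0|exact: integral0].
have -> : (fun w : trajectory R i.+1 => (centered_income w)%:E) =
    (fun w => (centered (thead w))%:E + (centered_income [tuple of behead w])%:E).
  by apply/funext => w; rewrite [in LHS](tuple_eta w) /centered_income big_cons.
have i1 := integrable_centered_thead (law P1 D M sigma m i).
have i2 := integrable_behead IHi.
split; first exact: (integrableD measurableT i1 i2).
rewrite [LHS](integralD measurableT i1 i2) integral_centered_thead add0e -[RHS]IH0.
exact: (integral_behead _ (measurable_int _ IHi)).
Qed.

Lemma integrable_applications N :
  (law P1 D M sigma m N).-integrable setT
    (fun w : trajectory R N => (applications action2 w)%:R%:E).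
Proof.
apply: (@le_integrable _ _ _ _ _ measurableT _ (cst N%:R%:E)).
- apply/measurable_EFinP.
  by apply: (measurableT_comp (f := fun n : nat => n%:R : R)) => //;
    exact: measurable_applications.
- move=> w _ /=; rewrite lee_fin !ger0_norm// ler_nat.
  by rewrite -[leqRHS](size_tuple w); exact: count_size.
- exact: finite_measure_integrable_cst.
Qed.

(** Since the centered incomes have mean [0], only the expected count of second actions remains: a
    nonnegative function of the state, as [expect_batch] requires. *)
Lemma lossE N : loss P1 D N M sigma m =
  (N%:R * Num.max 0 m)%:E -
  m%:E * expect P1 D M sigma m N (fun s => s.1.2%:R%:E).
Proof.
rewrite /loss; congr (_ - _); rewrite unlock /expect.
have [ic c0] := integral_centered_income N.
have ia := integrable_applications N.
transitivity (\int[law P1 D M sigma m N]_w ((centered_income w)%:E +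
    m%:E * (applications action2 w)%:R%:E)).
  apply: eq_integral => w _.
  by rewrite -EFinM -EFinD centered_incomeE subrK.
rewrite (integralD measurableT ic (integrableZl measurableT m ia)) c0 add0e.
exact: integralZl.
Qed.

End expected_loss.

(** * Minimax risks *)

Section precomposition.
Context d d' d'' (X : measurableType d) (Y : measurableType d')
  (Z : measurableType d'') (R : realType).
Variables (k : R.-pker Y ~> Z) (f : X -> Y) (mf : measurable_fun setT f).

(** The measurability proof is an argument, so that the kernel instances can be attached to the term
    itself. *)
Definition kprecomp of measurable_fun setT f :=
  fun x => k (f x) : {measure set Z -> \bar R}.

Let measurable_kprecomp U : measurable U ->
  measurable_fun setT ((kprecomp mf) ^~ U).
Proof.
by move=> mU; apply: (measurableT_comp (f := k ^~ U)) => //; exact: measurable_kernel.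
Qed.

HB.instance Definition _ :=
  isKernel.Build _ _ _ _ R (kprecomp mf) measurable_kprecomp.

Let kprecomp_prob x : kprecomp mf x setT = 1%E.
Proof. exact: prob_kernel. Qed.

HB.instance Definition _ :=
  Kernel_isProbability.Build _ _ _ _ R (kprecomp mf) kprecomp_prob.

End precomposition.

Section minimax.
Context {R : realType}.
Variables (P1 : probability (measurableTypeR R) R) (D : R) (hD : 0 < D).
Hypothesis hP1 : P1.-integrable [set: measurableTypeR R] (EFin \o idfun).
Hypothesis hP1_mean : ('E_P1[idfun] = 0)%E.
Variables (M : nat) (hM : (0 < M)%N).

Notation hist := (nat * measurableTypeR R * nat)%type.
Notation sqrtM := (Num.sqrt (M%:R : R)).

Let sqrtM_gt0 : 0 < sqrtM. Proof. by rewrite sqrtr_gt0 ltr0n. Qed.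

(** With [s = sqrt M] and [E n] taken in the one-by-one treatment: [M * K * max(0, m) = s * (K *
    max(0, s * m))] and [m * (M * E n) = s * (s * m * E n)]. *)
Lemma loss_rescale (sigma sigma1 : strategy R) K m :
  (forall h, sigma1 h = sigma (rescale M h) :> {measure set _ -> \bar R}) ->
  (loss P1 D (M * K) M sigma m =
   sqrtM%:E * loss P1 D K 1 sigma1 (sqrtM * m))%E.
Proof.
move=> sigma1E; rewrite !lossE//.
have mapp (c : nat) : measurable_fun setT
    (fun s : hist * bool => ((c * s.1.2)%N%:R%:E : \bar R)).
  apply/measurable_EFinP.
  apply: (measurableT_comp (f := fun n : nat => (c * n)%N%:R : R)) => //.
  exact: (measurableT_comp measurable_snd measurable_fst).
have mapp1 : measurable_fun setT (fun s : hist * bool => (s.1.2%:R%:E : \bar R)).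
  by apply: eq_measurable_fun (mapp 1%N) => s _; rewrite mul1n.
rewrite (expect_batch P1 hD hM m sigma1E K mapp1); last by move=> s; rewrite lee_fin.
have ia := integrable_applications P1 D 1 sigma1 (sqrtM * m) K.
set e := expect _ _ _ _ _ _ _.
have -> : e = (M%:R%:E * expect P1 D 1 sigma1 (sqrtM * m) K
    (fun s => s.1.2%:R%:E))%E.
  rewrite -[RHS](integralZl measurableT ia); apply: eq_integral => w _.
  by rewrite /= natrM EFinM.
(* The expected count is finite, so the claim becomes an identity between real numbers. *)
rewrite -[expect _ _ _ _ _ _ _](fineK (integrable_fin_num measurableT ia)).
rewrite -!EFinM -!EFinB; congr EFin.
have -> : Num.max 0 (sqrtM * m) = sqrtM * Num.max 0 m.
  by rewrite maxr_pMr ?mulr0// ltW.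
have MM : M%:R = sqrtM * sqrtM by rewrite -expr2 sqr_sqrtr.
rewrite natrM; move: (fine _) => r; move: MM; generalize sqrtM => s ->; ring.
Qed.

Lemma minimax_risk_rescale K C :
  (minimax_risk P1 D (M * K) M (parameters (C / sqrtM)) =
   sqrtM%:E * minimax_risk P1 D K 1 (parameters C))%E.
Proof.
have sup_rescale (sigma sigma1 : strategy R) :
    (forall h, sigma1 h = sigma (rescale M h) :> {measure set _ -> \bar R}) ->
    ereal_sup [set loss P1 D (M * K) M sigma m | m in parameters (C / sqrtM)] =
    (sqrtM%:E * ereal_sup [set loss P1 D K 1 sigma1 m | m in parameters C])%E.
  move=> sigma1E; rewrite -ereal_sup_pZl//; congr ereal_sup.
  (* Multiplication by [sqrtM] maps [parameters (C / sqrtM)] onto [parameters C]. *)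
  apply/seteqP; split => [_ [m Cm <-]|_ [_ [m Cm <-] <-]].
    exists (loss P1 D K 1 sigma1 (sqrtM * m)); last exact/esym/loss_rescale.
    exists (sqrtM * m) => //; move: Cm; rewrite /parameters/= normrM gtr0_norm//.
    by rewrite ler_pdivlMr// mulrC.
  exists (m / sqrtM); last first.
    by rewrite (loss_rescale _ _ sigma1E) mulrC divfK// gt_eqF.
  move: Cm; rewrite /parameters/= normrM => Cm.
  by rewrite [X in _ * X]gtr0_norm ?invr_gt0// ler_pM2r ?invr_gt0.
rewrite /minimax_risk -ereal_inf_pZl//; congr ereal_inf.
apply/seteqP; split => [_ [sigma _ <-]|_ [_ [sigma1 _ <-] <-]].
  pose sigma1 : strategy R := kprecomp sigma (@measurable_rescale R M).
  exists (ereal_sup [set loss P1 D K 1 sigma1 m | m in parameters C]).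
    by exists sigma1.
  exact/esym/sup_rescale.
(* A left inverse of [rescale]. Integer division makes it total, which gives the batch strategy
   values at all histories. *)
pose unscale (h : hist) : hist := ((h.1.1 %/ M)%N, h.1.2 / sqrtM, (h.2 %/ M)%N).
have munscale : measurable_fun setT unscale.
  apply/measurable_fun_pairP; split; last first.
    by apply: (measurableT_comp (f := divn^~ M)).
  apply/measurable_fun_pairP; split.
    apply: (measurableT_comp (f := divn^~ M)) => //.
    exact: (measurableT_comp measurable_fst measurable_fst).
  apply: measurable_funM => //.
  exact: (measurableT_comp measurable_snd measurable_fst).
exists (kprecomp sigma1 munscale : strategy R) => //.
have rescaleK : cancel (rescale M) unscale.
  move=> [[k X] n]; rewrite /unscale /rescale/= !mulKn// mulrAC divff ?mul1r//.
  by rewrite gt_eqF.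
by apply: sup_rescale => h; rewrite -[in LHS](rescaleK h).
Qed.

End minimax.

Theorem corollary2p1 (R : realType) (C D : R) (hC : 0 < C) (hD : 0 < D)
    (P1 : probability (measurableTypeR R) R)
    (hP1 : P1.-integrable [set: measurableTypeR R] (EFin \o idfun))
    (hP1_mean : ('E_P1[idfun] = 0)%E) :
  (forall M K : nat, (0 < M)%N -> (0 < K)%N ->
    ((((M * K)%:R `^ (- 2^-1))%:E *
        minimax_risk P1 D (M * K) M (parameters (C * M%:R `^ (- 2^-1)))) =
     ((K%:R `^ (- 2^-1))%:E * minimax_risk P1 D K 1 (parameters C)))%E)
  /\
  (exists r : nat -> \bar R, forall M K : nat, (0 < M)%N -> (0 < K)%N ->
    ((((M * K)%:R `^ (- 2^-1))%:E *
        minimax_risk P1 D (M * K) M (parameters (C * M%:R `^ (- 2^-1)))) =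
     r K)%E).
Proof.
suff scaling M K : (0 < M)%N -> (0 < K)%N ->
    ((((M * K)%:R `^ (- 2^-1))%:E *
        minimax_risk P1 D (M * K) M (parameters (C * M%:R `^ (- 2^-1)))) =
     ((K%:R `^ (- 2^-1))%:E * minimax_risk P1 D K 1 (parameters C)))%E.
  split; first exact: scaling.
  (* The one-by-one side, in which [M] does not occur, serves as [r]. *)
  by exists (fun K => ((K%:R `^ (- 2^-1))%:E * minimax_risk P1 D K 1 (parameters C))%E).
move=> M0 K0; have sqrtE (n : nat) : n%:R `^ (- 2^-1) = (Num.sqrt n%:R)^-1 :> R.
  by rewrite powRN powR12_sqrt.
(* The factor [sqrt M] from the risk cancels against the one in [(sqrt (M * K))^-1]. *)
rewrite !sqrtE minimax_risk_rescale// muleA -EFinM; congr (_%:E * _)%E.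
rewrite natrM sqrtrM// invfM mulrAC mulVf ?mul1r//.
by rewrite gt_eqF// sqrtr_gt0 ltr0n.
Qed.
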